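(* Let $n$ be a positive integer, let $\mathcal{D}_1$ be an $n$-diagram over a $t_1$-family of cubes $\mathcal{C}_1$ and $\mathcal{D}_2$ an $n$-diagram over a $t_2$-family of cubes $\mathcal{C}_2$, and let $\mathcal{D}=\mathcal{D}_1\cap\mathcal{D}_2$ be their intersection, an $n$-diagram over a $(t_1+t_2)$-family of cubes. Then, as subgroups of $\mathcal{S}_n$, $$\mathrm{Aut}(\mathcal{D}_1)\cap\mathrm{Aut}(\mathcal{D}_2)=\mathrm{Aut}(\mathcal{D}).$$
   Context: **Cubes.** For a finite (possibly empty) set $I$ of positive integers, an $I$-cube is the collection of all subsets of $I$; $I$ is its index set. For an integer $t\ge 0$, a $t$-family of cubes is a collection $\mathcal{C}=\{K_1,\ldots,K_p\}$ where each $K_j$ is an $I(j)$-cube for some $I(j)\subseteq\{1,\ldots,t\}$ (so it is specified by a function $I:[p]\to 2^{[t]}$; different $K_j$ are distinguished even if their index sets coincide). The vertices of an $I$-cube $K$ are the pairs $(K,v)$, $v\subseteq I$, and $\mathrm{vert}(\mathcal{C})$ is the set of all vertices of all cubes in $\mathcal{C}$. **Diagrams.** An $n$-diagram over $\mathcal{C}$ is a function $\mathcal{D}:[n]\to\mathrm{vert}(\mathcal{C})$, $k\mapsto(K_{\alpha(k)},v_k)$, with $\alpha(k)\in[p]$, $v_k\subseteq I(\alpha(k))$. The fiber over a vertex $(K,v)$ is $\mathcal{D}^{-1}(K,v)$; the fiber over an $I$-cube $K$ is $\mathcal{D}^{-1}(K)=\bigcup_{v\subseteq I}\mathcal{D}^{-1}(K,v)$.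 **Automorphism group.** Subsets of $I$ are identified with vectors in $\mathbb{Z}_2^I$ (the $\mathbb{F}_2$-vector space with coordinates indexed by $I$), and $\mathbb{Z}_2^I$ acts on the $I$-cube by translation: $\tau(v)=v+\tau$. Let $\mathrm{proj}_I:\mathbb{Z}_2^t\to\mathbb{Z}_2^I$ be the coordinate projection. $\mathrm{Aut}(\mathcal{D})$ consists of all $\pi\in\mathcal{S}_n$ such that (i) $\pi$ maps $\mathcal{D}^{-1}(K_j)$ to itself for all $j\in[p]$; and (ii) there exists $\sigma\in\mathbb{Z}_2^t$ such that $v_{\pi(k)}=\sigma_{\alpha(k)}(v_k)$ for all $k\in[n]$, where $\sigma_j=\mathrm{proj}_{I(j)}(\sigma)$. **Intersection.** Let $\mathcal{C}_1=\{K_1,\ldots,K_p\}$ with $K_i$ an $I_1(i)$-cube, $\mathcal{C}_2=\{L_1,\ldots,L_q\}$ with $L_j$ an $I_2(j)$-cube, $\mathcal{D}_1(k)=(K_{\alpha_1(k)},v_k^{(1)})$ and $\mathcal{D}_2(k)=(L_{\alpha_2(k)},v_k^{(2)})$. The intersection $\mathcal{D}_1\cap\mathcal{D}_2$ is the $n$-diagram over the $(t_1+t_2)$-family $\mathcal{C}=\{M_{i,j}\}_{i\in[p],j\in[q]}$, where $M_{i,j}$ is an $I(i,j)$-cube with $I(i,j)=I_1(i)\cup\{x+t_1\mid x\in I_2(j)\}$, given by $$k\mapsto\big(M_{\alpha_1(k),\alpha_2(k)},\ v_k^{(1)}\cup\{x+t_1\mid x\in v_k^{(2)}\}\big).$$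 *)

(* Defs.v *)
From mathcomp Require Import all_boot all_order all_algebra all_fingroup.

Set Implicit Arguments.
Unset Strict Implicit.
Unset Printing Implicit Defensive.

Import GRing.Theory.

(* The ground set {1, ..., t} is represented by 'I_t.  The cubes of a family
   are labelled by a finite type J (so cubes with equal index sets remain
   distinct): J is 'I_p for {K_1, ..., K_p}, and 'I_p * 'I_q for {M_(i,j)}. *)
Definition cube_family (t : nat) (J : finType) := J -> {set 'I_t}.

Definition vert (t : nat) (J : finType) (C : cube_family t J) :=
  {x : J * {set 'I_t} | x.2 \subset C x.1}.

Definition cube_of (t : nat) (J : finType) (C : cube_family t J)
  (x : vert C) : J := (val x).1.

Definition subset_of (t : nat) (J : finType) (C : cube_family t J)
  (x : vert C) : {set 'I_t} := (val x).2.

Definition diagram (n t : nat) (J : finType) (C : cube_family t J) :=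
  'I_n -> vert C.

Definition vertex_fiber (n t : nat) (J : finType) (C : cube_family t J)
  (D : diagram n C) (x : vert C) : {set 'I_n} := [set k | D k == x].

Definition cube_fiber (n t : nat) (J : finType) (C : cube_family t J)
  (D : diagram n C) (j : J) : {set 'I_n} :=
  \bigcup_(x : vert C | cube_of x == j) vertex_fiber D x.

(* Z_2^I, with its pointwise additive group structure. *)
Notation Z2vec I := {ffun {i | i \in I} -> 'F_2}.

Definition vec_of_set (t : nat) (I v : {set 'I_t}) : Z2vec I :=
  [ffun i => ((val i \in v)%:R)%R].

Definition set_of_vec (t : nat) (I : {set 'I_t}) (x : Z2vec I) : {set 'I_t} :=
  [set val i | i in [set i | x i == 1%R]].

(* v |-> v + tau on the I-cube; meaningful for v \subset I. *)
Definition translate (t : nat) (I : {set 'I_t}) (tau : Z2vec I)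
  (v : {set 'I_t}) : {set 'I_t} := set_of_vec (vec_of_set I v + tau)%R.

Definition proj (t : nat) (I : {set 'I_t}) (sigma : {ffun 'I_t -> 'F_2}) :
  Z2vec I := [ffun i => sigma (val i)].

Definition diagram_Aut (n t : nat) (J : finType) (C : cube_family t J)
  (D : diagram n C) : {set 'S_n} :=
  [set pi : 'S_n |
    [forall j : J, pi @: cube_fiber D j == cube_fiber D j] &&
    [exists sigma : {ffun 'I_t -> 'F_2}, forall k : 'I_n,
      subset_of (D (pi k)) ==
      translate (proj (C (cube_of (D k))) sigma) (subset_of (D k))]].

Lemma vec_of_setK (t : nat) (I v : {set 'I_t}) :
  v \subset I -> set_of_vec (vec_of_set I v) = v.
Proof.
move=> /subsetP sub; apply/setP => i; apply/imsetP/idP => [[j]|vi].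
  by rewrite inE ffunE => + ->; case: (_ \in v).
by exists (Sub i (sub i vi)); rewrite // inE ffunE /= vi.
Qed.

Lemma set_of_vecK (t : nat) (I : {set 'I_t}) (x : Z2vec I) :
  vec_of_set I (set_of_vec x) = x.
Proof.
apply/ffunP => i; rewrite ffunE mem_imset ?inE; last exact: val_inj.
by case: (x i) => -[|[|m]] // lt_m; apply: val_inj.
Qed.

Lemma mem_cube_fiber (n t : nat) (J : finType) (C : cube_family t J)
  (D : diagram n C) (j : J) (k : 'I_n) :
  (k \in cube_fiber D j) = (cube_of (D k) == j).
Proof.
apply/bigcupP/idP => [[x xj]|Dkj]; first by rewrite inE => /eqP ->.
by exists (D k); rewrite // inE.
Qed.

Lemma diagram_Aut_group_set (n t : nat) (J : finType) (C : cube_family t J)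
  (D : diagram n C) : group_set (diagram_Aut D).
Proof.
apply/group_setP; split=> [|pi rho].
  rewrite inE; apply/andP; split.
    apply/forallP => j; apply/eqP/setP => k; apply/imsetP/idP => [[i ij ->]|kj].
      by rewrite perm1.
    by exists k; rewrite ?perm1.
  apply/existsP; exists 0%R; apply/forallP => k; rewrite perm1 /translate.
  have -> : proj (C (cube_of (D k))) 0%R = 0%R by apply/ffunP => i; rewrite !ffunE.
  by rewrite addr0 vec_of_setK //; exact: (valP (D k)).
rewrite !inE => /andP[/forallP fib1 /existsP[s1 /forallP tr1]].
move=> /andP[/forallP fib2 /existsP[s2 /forallP tr2]]; apply/andP; split.
  apply/forallP => j; rewrite -{2}(eqP (fib2 j)) -{2}(eqP (fib1 j)) -imset_comp.
  by apply/eqP/eq_imset => k /=; rewrite permM.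
apply/existsP; exists (s1 + s2)%R; apply/forallP => k.
have Ek : cube_of (D (pi k)) = cube_of (D k).
  apply/eqP; rewrite -mem_cube_fiber -(eqP (fib1 _)) imset_f //.
  by rewrite mem_cube_fiber.
rewrite permM (eqP (tr2 _)) Ek (eqP (tr1 _)) /translate set_of_vecK -addrA.
by apply/eqP; congr (set_of_vec (_ + _)%R); apply/ffunP => i; rewrite !ffunE.
Qed.

Canonical diagram_Aut_group (n t : nat) (J : finType) (C : cube_family t J)
  (D : diagram n C) := Group (diagram_Aut_group_set D).

(* Disjoint union of v1 with the shift {x + t1 | x in v2}. *)
Definition join_set (t1 t2 : nat) (v1 : {set 'I_t1}) (v2 : {set 'I_t2}) :
  {set 'I_(t1 + t2)} := (lshift t2 @: v1) :|: (@rshift t1 t2 @: v2).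

Definition family_cap (t1 t2 : nat) (J1 J2 : finType)
  (C1 : cube_family t1 J1) (C2 : cube_family t2 J2) :
  cube_family (t1 + t2) (J1 * J2)%type :=
  fun ij => join_set (C1 ij.1) (C2 ij.2).

Lemma join_setS (t1 t2 : nat) (J1 J2 : finType)
  (C1 : cube_family t1 J1) (C2 : cube_family t2 J2)
  (x : vert C1) (y : vert C2) :
  join_set (subset_of x) (subset_of y)
    \subset family_cap C1 C2 (cube_of x, cube_of y).
Proof.
by apply: setUSS; apply: imsetS; [exact: (valP x) | exact: (valP y)].
Qed.

Definition diagram_cap (n t1 t2 : nat) (J1 J2 : finType)
  (C1 : cube_family t1 J1) (C2 : cube_family t2 J2)
  (D1 : diagram n C1) (D2 : diagram n C2) : diagram n (family_cap C1 C2) :=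
  fun k =>
    exist (fun z : (J1 * J2) * {set 'I_(t1 + t2)} =>
             z.2 \subset family_cap C1 C2 z.1)
      ((cube_of (D1 k), cube_of (D2 k)),
       join_set (subset_of (D1 k)) (subset_of (D2 k)))
      (join_setS (D1 k) (D2 k)).

(* Main.v *)
(* A vector of Z_2^(t1 + t2) is a pair of vectors of Z_2^t1 and Z_2^t2, and
   translating a joined cube acts separately on its two blocks of coordinates.
   Hence one sigma serves the intersection exactly when its two halves serve
   the two diagrams; the fibers over M_(i,j) are likewise the intersections of
   the fibers over K_i and L_j. *)
Require Import Defs.
From mathcomp Require Import all_boot all_order all_algebra all_fingroup.

(** Eliminates the vectors indexed by the subtype of elements of [I], so that equalities of
    translates can be checked one coordinate at a time. *)
Lemma mem_translate (t : nat) (I v : {set 'I_t}) (sigma : {ffun 'I_t -> 'F_2})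
    (i : 'I_t) :
  (i \in translate (proj I sigma) v)
    = (i \in I) && (((i \in v)%:R + sigma i)%R == 1%R).
Proof.
apply/imsetP/andP => [[j]|[iI Hi]].
  by rewrite inE !ffunE => Hj ->; split=> //; exact: valP j.
by exists (Sub i iI); rewrite // inE !ffunE.
Qed.

Lemma mem_join_lshift (t1 t2 : nat) (v1 : {set 'I_t1}) (v2 : {set 'I_t2})
    (i : 'I_t1) :
  (lshift t2 i \in join_set v1 v2) = (i \in v1).
Proof.
rewrite inE mem_imset; last exact: lshift_inj.
by case: imsetP => [[j _ /eqP]|]; rewrite ?eq_lrshift ?orbF.
Qed.

Lemma mem_join_rshift (t1 t2 : nat) (v1 : {set 'I_t1}) (v2 : {set 'I_t2})
    (i : 'I_t2) :
  (rshift t1 i \in join_set v1 v2) = (i \in v2).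
Proof.
rewrite inE orbC mem_imset; last exact: rshift_inj.
by case: imsetP => [[j _ /eqP]|]; rewrite ?eq_rlshift ?orbF.
Qed.

(** The two blocks of coordinates are disjoint, so each component can be read off from its own
    block. *)
Lemma join_set_inj (t1 t2 : nat) (v1 w1 : {set 'I_t1}) (v2 w2 : {set 'I_t2}) :
  join_set v1 v2 = join_set w1 w2 -> v1 = w1 /\ v2 = w2.
Proof.
move=> /setP E; split; apply/setP => i.
  by rewrite -(mem_join_lshift _ _ v1 v2) E mem_join_lshift.
by rewrite -(mem_join_rshift _ _ v1 v2) E mem_join_rshift.
Qed.

Lemma translate_join (t1 t2 : nat) (I1 v1 : {set 'I_t1}) (I2 v2 : {set 'I_t2})
    (sigma : {ffun 'I_(t1 + t2) -> 'F_2}) :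
  translate (proj (join_set I1 I2) sigma) (join_set v1 v2)
    = join_set (translate (proj I1 [ffun i => sigma (lshift t2 i)]) v1)
               (translate (proj I2 [ffun i => sigma (rshift t1 i)]) v2).
Proof.
apply/setP => i; rewrite -(splitK i); case: (split i) => j /=.
  by rewrite mem_translate !mem_join_lshift mem_translate ffunE.
by rewrite mem_translate !mem_join_rshift mem_translate ffunE.
Qed.

(** Each [k] lies only in the fiber of its own cube, so stabilising all cube fibers is a pointwise
    condition on labels. *)
Lemma diagram_AutP (n t : nat) (J : finType) (C : cube_family t J)
    (D : diagram n C) (pi : 'S_n) :
  reflect
    ((forall k, cube_of (D (pi k)) = cube_of (D k)) /\
     exists sigma : {ffun 'I_t -> 'F_2}, forall k,
       subset_of (D (pi k))
         = translate (proj (C (cube_of (D k))) sigma) (subset_of (D k)))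
    (pi \in diagram_Aut D).
Proof.
rewrite inE; apply: (iffP andP) => -[fib tr]; split.
- move=> k; apply/eqP; rewrite -mem_cube_fiber -(eqP (forallP fib _)).
  by rewrite imset_f // mem_cube_fiber.
- by case/existsP: tr => s /forallP tr; exists s => k; exact/eqP.
(* One inclusion is enough: [pi] is injective, so the fiber and its image have the same size. *)
- apply/forallP => j; rewrite eqEcard card_imset ?leqnn ?andbT; last exact: perm_inj.
  by apply/subsetP => _ /imsetP[k kj ->]; rewrite mem_cube_fiber fib -mem_cube_fiber.
- by case: tr => s tr; apply/existsP; exists s; apply/forallP => k; exact/eqP.
Qed.

Theorem theorem6p8 (n t1 t2 p q : nat) (hn : 0 < n)
  (C1 : cube_family t1 'I_p) (C2 : cube_family t2 'I_q)
  (D1 : diagram n C1) (D2 : diagram n C2) :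
  (diagram_Aut_group D1 :&: diagram_Aut_group D2)%G
    = diagram_Aut_group (diagram_cap D1 D2) :> {group 'S_n}.
Proof.
apply/val_inj/setP => pi /=; rewrite inE.
apply/andP/diagram_AutP.
  move=> [/diagram_AutP[fib1 [s1 tr1]] /diagram_AutP[fib2 [s2 tr2]]].
  split=> [k|]; first by rewrite /cube_of /= fib1 fib2.
  (* The two vectors are glued: [s1] on the first [t1] coordinates, [s2] on the remaining [t2]. *)
  exists [ffun i => match split i with inl j => s1 j | inr j => s2 j end] => k.
  have -> : subset_of (diagram_cap D1 D2 (pi k))
      = join_set (subset_of (D1 (pi k))) (subset_of (D2 (pi k))) by [].
  rewrite tr1 tr2 translate_join.
  congr (join_set (translate (proj _ _) _) (translate (proj _ _) _));
    apply/ffunP => i; rewrite !ffunE.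
    by rewrite -[lshift _ _]/(unsplit (inl i)) unsplitK.
  by rewrite -[rshift _ _]/(unsplit (inr i)) unsplitK.
move=> [fib [s tr]].
(* By [translate_join] both sides of [tr k] are joined sets, so the equality splits into one for
   each diagram. *)
have {}tr k := join_set_inj _ _ _ _ _ _
  (etrans (tr k) (translate_join _ _ _ _ _ _ _)).
split; apply/diagram_AutP; split.
- by move=> k; case: (fib k).
(* Unification with [tr] supplies the witness: the restriction of [s] to the first block, and to the
   second block in the last case. *)
- by eexists => k; case: (tr k) => + _; exact.
- by move=> k; case: (fib k).
- by eexists => k; case: (tr k) => _; exact.
Qed.
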